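(* (Mather graph property) Let $\Gamma$ be a finite connected graph without loops, with a Hamiltonian $\mathcal H$ and associated Lagrangian $\mathcal L$. For every $c\in H^1(\Gamma,\mathbb R)$ and every $h\in H_1(\Gamma,\mathbb R)$, the restriction of the (multivalued) projection $\pi_E$ to $\widetilde{\mathcal M}_c$, and its restriction to $\widetilde{\mathcal M}^h$, are injective.
   Context: Graph. $\Gamma=(V,E)$ consists of disjoint finite sets $V$ (vertices) and $E\neq\emptyset$ (directed edges), a map $o:E\to V$ (origin) and a fixed-point-free involution $e\mapsto -e$ of $E$; $t(e):=o(-e)$. A path is a finite sequence of edges $(e_i)_{i=1}^M$ with $t(e_i)=o(e_{i+1})$. $\Gamma$ is connected (any two vertices are linked by a path) and has no loops ($o(e)\ne t(e)$). (Co)homology. $C_0$ is the real vector space with basis $V$; $C_1$ is the real vector space generated by $E$ with the edge $-e$ identified with the opposite of $e$; $\partial e=t(e)-o(e)$; $H_1(\Gamma,\mathbb R)=\ker\partial\subset C_1$. $C^0$ = functions $V\to\mathbb R$; $C^1$ = functions $\omega:E\to\mathbb R$ with $\omega(-e)=-\omega(e)$; $dg(e)=g(t(e))-g(o(e))$; $H^1(\Gamma,\mathbb R)=C^1/dC^0$. The pairing $\langle\omega,e\rangle=\omega(e)$ extends linearly to $C^1\times C_1$ and descends to $H^1\times H_1$. Tangent bundle and measures. $T\Gamma=(E\times[0,+\infty))/\sim$, where $(e,0)\sim(-e,0)$; $\mathbb R^+_e:=\{e\}\times[0,+\infty)$. The metric is $d((e_1,q_1),(e_2,q_2))=q_1+q_2+1$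 if $e_1\ne\pm e_2$, $|q_1-q_2|$ if $e_1=e_2$, $q_1+q_2$ if $e_1=-e_2$. $\mathbb P$ is the set of Borel probability measures on $T\Gamma$ with $\int q\,d\mu<+\infty$, with the first Wasserstein distance. For $\mu\in\mathbb P$, $\rho(\mu)=\sum_{e\in E}\big(\int_{\mathbb R^+_e}q\,d\mu\big)e\in C_1$ and, for $\omega\in C^1$, $\int\omega\,d\mu:=\langle\omega,\rho(\mu)\rangle$. $\mu$ is closed if $\int df\,d\mu=0$ for all $f\in C^0$, equivalently $\rho(\mu)\in H_1(\Gamma,\mathbb R)$; $\mathbb M\subset\mathbb P$ is the set of closed measures. Hamiltonian and Lagrangian. A Hamiltonian is a family $\mathcal H(e,\cdot):\mathbb R\to\mathbb R$, $e\in E$, with $\mathcal H(e,p)=\mathcal H(-e,-p)$, each strictly convex, differentiable and superlinear ($\mathcal H(e,p)/|p|\to+\infty$ as $p\to\pm\infty$). $\mathcal L(e,q)=\max_{p}(pq-\mathcal H(e,p))$, well defined on $T\Gamma$; for $\omega\in C^1$, $\mathcal L^\omega(e,q)=\mathcal L(e,q)-q\,\omega(e)$. Mather theory. $\beta(h)=\min\{\int\mathcal L\,d\mu:\mu\in\mathbb M,\rho(\mu)=h\}$ for $h\in H_1(\Gamma,\mathbb R)$; $\alpha(c)=\max_{h}(\langle c,h\rangle-\beta(h))=-\min_{\mu\in\mathbb M}\int\mathcal L^\omega d\mu$ for $c\in H^1(\Gamma,\mathbb R)$, $\omega$ any representative of $c$. $\mathbb M^h$ is the set of $\mu\in\mathbb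 M$ with $\rho(\mu)=h$ and $\int\mathcal L\,d\mu=\beta(h)$; $\mathbb M_c$ is the set of $\mu\in\mathbb M$ with $\int\mathcal L^\omega d\mu=-\alpha(c)$. $\widetilde{\mathcal M}^h=\bigcup_{\mu\in\mathbb M^h}\operatorname{supp}\mu$, $\widetilde{\mathcal M}_c=\bigcup_{\mu\in\mathbb M_c}\operatorname{supp}\mu$, subsets of $T\Gamma$. Projection. $\pi_E$ is the multivalued map from $T\Gamma$ to $E$ with $\pi_E(e,q)=\{e\}$ if $q>0$ and $\pi_E(e,0)=\{e,-e\}$. Injectivity of its restriction to a set $A\subset T\Gamma$ means that distinct points of $A$ have disjoint images, so that the inverse is a well-defined (single-valued) map from $\pi_E(A)$ to $A$. *)

(* Defs.v *)
From HB Require Import structures.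
From mathcomp Require Import all_boot all_order all_algebra.
From mathcomp Require Import generic_quotient ring_quotient.
From mathcomp Require Import all_classical all_reals all_analysis.
From mathcomp Require Import ring lra.

Set Implicit Arguments.
Unset Strict Implicit.
Unset Printing Implicit Defensive.
Import Order.TTheory GRing.Theory Num.Theory.
Import numFieldNormedType.Exports.

Local Open Scope classical_set_scope.
Local Open Scope ring_scope.

Record graph := Graph {
  vertex : finType;
  edge : finType;
  edge_gt0 : (0 < #|edge|)%N;
  origin : edge -> vertex;
  opp : edge -> edge;
  oppK : involutive opp;
  opp_neq : forall e, opp e != e
}.

Section Graph.
Variable G : graph.
Implicit Types e f : edge G.

Definition target e := origin (opp e).

Definition consecutive : rel (edge G) := fun e f => target e == origin f.

(* The path is the nonempty sequence [e :: p], joining distinct vertices;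
   [path] is the library predicate on sequences. *)
Definition connected_graph := forall v w : vertex G, v != w ->
  exists e p, [/\ path consecutive e p, origin e = v & target (last e p) = w].

Definition loopless := forall e, origin e != target e.

Lemma opp_inj : injective (@opp G).
Proof. exact: inv_inj (@oppK G). Qed.

Lemma opp_swap e f : (opp e == f) = (e == opp f).
Proof. by rewrite -(inj_eq opp_inj) oppK. Qed.

End Graph.

Section QuotientModule.
Variables (R : nzRingType) (V : lmodType R) (S : zmodClosed V).
Hypothesis SZ : forall a x, x \in S -> a *: x \in S.
Local Notation Q := (Quotient.quot S).
Local Open Scope quotient_scope.

Definition quot_scale (a : R) (x : Q) : Q := \pi_Q (a *: repr x).

Lemma quot_eqP (x y : V) : reflect (\pi_Q x = \pi_Q y) (x - y \in S).
Proof. by rewrite Quotient.idealrBE; exact: eqP. Qed.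

Lemma quot_piZ a (x : V) : quot_scale a (\pi_Q x) = \pi_Q (a *: x).
Proof.
apply/quot_eqP; rewrite -scalerBr SZ//.
by apply/quot_eqP; rewrite reprK.
Qed.

Lemma quot_scaleA a b (x : Q) :
  quot_scale a (quot_scale b x) = quot_scale (a * b) x.
Proof. by rewrite -[x]reprK !quot_piZ scalerA !reprK. Qed.

Lemma quot_scale1 : left_id 1 quot_scale.
Proof. by move=> x; rewrite -[x]reprK !quot_piZ scale1r. Qed.

Lemma quot_scaleDr : right_distributive quot_scale +%R.
Proof.
move=> a x y; rewrite -[x]reprK -[y]reprK.
by rewrite -(raddfD (\pi_Q)) !quot_piZ scalerDr raddfD.
Qed.

Lemma quot_scaleDl (x : Q) : {morph quot_scale^~ x : a b / a + b}.
Proof.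
move=> a b; rewrite -[x]reprK !quot_piZ.
by rewrite -(raddfD (\pi_Q)) scalerDl.
Qed.

(* Evaluating at [repr] a linear map that vanishes on [S] is the induced map. *)
Lemma quot_lift (W : zmodType) (f : {additive V -> W}) (x : V) :
  (forall y, y \in S -> f y = 0) -> f (repr (\pi_Q x)) = f x.
Proof.
move=> f0; apply/eqP; rewrite -subr_eq0 -raddfB; apply/eqP/f0.
by apply/quot_eqP; rewrite reprK.
Qed.

End QuotientModule.


Section Homology.
Variables (R : realType) (G : graph).
Implicit Types e f : edge G.
Local Open Scope quotient_scope.

Definition chain0 := {ffun vertex G -> R^o}.
Definition vertex_chain (v : vertex G) : chain0 := [ffun w => (w == v)%:R].

Definition edge_space := {ffun edge G -> R^o}.
Definition free_edge e : edge_space := [ffun f => (f == e)%:R].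
Definition opp_relations : {vspace edge_space} :=
  <<[seq (free_edge e + free_edge (opp e))%R | e <- enum (edge G)]>>%VS.
Lemma opp_relationsZ a (x : edge_space) :
  x \in opp_relations -> a *: x \in opp_relations.
Proof. exact: rpredZ. Qed.

Definition chain1 : Type := Quotient.quot (pred_of_vspace opp_relations).
HB.instance Definition _ := EqQuotient.on chain1.
HB.instance Definition _ := GRing.Zmodule.on chain1.
HB.instance Definition _ := GRing.Zmodule_isLmodule.Build R chain1
  (quot_scaleA opp_relationsZ) (quot_scale1 opp_relationsZ)
  (quot_scaleDr opp_relationsZ) (quot_scaleDl opp_relationsZ).
Definition edge_chain e : chain1 := \pi_chain1 (free_edge e).

Lemma edge_space_sum (x : edge_space) : x = \sum_e x e *: free_edge e.
Proof.
apply/ffunP => f; rewrite sum_ffunE (bigD1 f)//= !ffunE eqxx big1.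
  by rewrite addr0 [RHS]mulr1.
by move=> e ef; rewrite !ffunE eq_sym (negbTE ef) [LHS]mulr0.
Qed.

(* The linear map on the edge space extending [u]; it descends to [chain1]
   when [u (opp e) = - u e]. *)
Definition extend (W : lmodType R) (u : edge G -> W) (x : edge_space) : W :=
  \sum_e (x e : R) *: u e.

Lemma extend_linear (W : lmodType R) (u : edge G -> W) : linear (extend u).
Proof.
move=> a x y; rewrite /extend scaler_sumr -big_split/=; apply: eq_bigr => e _.
by rewrite !ffunE scalerDl scalerA.
Qed.

HB.instance Definition _ (W : lmodType R) (u : edge G -> W) :=
  GRing.isLinear.Build R edge_space W _ (extend u) (extend_linear u).

Lemma extend_edge (W : lmodType R) (u : edge G -> W) e :
  extend u (free_edge e) = u e.
Proof.
rewrite /extend (bigD1 e)//= big1 => [|f fe]; rewrite ffunE.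
  by rewrite eqxx scale1r addr0.
by rewrite (negbTE fe) scale0r.
Qed.

Lemma extend0 (W : lmodType R) (u : edge G -> W) (x : edge_space) :
  (forall e, u (opp e) = - u e) -> x \in opp_relations -> extend u x = 0.
Proof.
move=> uN /coord_span ->; rewrite linear_sum big1// => i _.
rewrite linearZ; set y := nth _ _ _.
have : y \in [seq free_edge e + free_edge (opp e) | e <- enum (edge G)].
  by rewrite mem_nth// size_map -cardE.
by case/mapP => e _ ->; rewrite linearD/= !extend_edge uN subrr scaler0.
Qed.

(* [boundary] and [pairing] below are evaluated on a representative; the
   lemmas [boundary_pi] and [pairing_pi] give independence of its choice. *)
Definition boundary (x : chain1) : chain0 :=
  extend (fun e => vertex_chain (target e) - vertex_chain (origin e)) (repr x).

Lemma boundary_pi (x : edge_space) : boundary (\pi_chain1 x) =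
  extend (fun e => vertex_chain (target e) - vertex_chain (origin e)) x.
Proof.
apply: quot_lift => y; apply: extend0 => e.
by rewrite /target oppK opprB.
Qed.

Lemma boundary_edge e :
  boundary (edge_chain e) = vertex_chain (target e) - vertex_chain (origin e).
Proof. by rewrite boundary_pi extend_edge. Qed.

Definition homology1 : set chain1 := [set x | boundary x = 0].

Definition cochain0 := vertex G -> R.

Definition antisymmetric : {pred edge_space} :=
  fun w => [forall e, w (opp e) == - w e].

Lemma antisymmetric_submod : submod_closed antisymmetric.
Proof.
split; first by apply/forallP => e; rewrite !ffunE oppr0.
move=> a x y /forallP xN /forallP yN; apply/forallP => e.
by rewrite !ffunE (eqP (xN e)) (eqP (yN e)) scalerN -opprD.
Qed.

HB.instance Definition _ := GRing.isSubmodClosed.Build R edge_space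
  antisymmetric (GRing.submod_closed_semi antisymmetric_submod).

Record cochain1 := Cochain1 {
  cochain1_val :> {ffun edge G -> R^o};
  _ : cochain1_val \in antisymmetric
}.

HB.instance Definition _ := [isSub for cochain1_val].
HB.instance Definition _ := [Choice of cochain1 by <:].
HB.instance Definition _ := [SubChoice_isSubLmodule of cochain1 by <:].

Lemma cochain1N (w : cochain1) e : w (opp e) = - w e.
Proof. by case: w => w /= /forallP/(_ e)/eqP. Qed.

Fact differential_subproof (g : cochain0) :
  [ffun e => g (target e) - g (origin e) : R^o] \in antisymmetric.
Proof. by apply/forallP => e; rewrite !ffunE /target oppK opprB. Qed.

Definition differential (g : cochain0) : cochain1 :=
  Cochain1 (differential_subproof g).

Definition exact_form : {pred cochain1} :=
  fun w => `[< exists g, w = differential g >].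

Lemma exact_form_submod : submod_closed exact_form.
Proof.
split.
  apply/asboolP; exists (fun=> 0); apply/val_inj/ffunP => e.
  by rewrite !ffunE subrr.
move=> a x y /asboolP[g ->] /asboolP[h ->]; apply/asboolP.
exists (fun v => a * g v + h v); apply/val_inj/ffunP => e.
rewrite !ffunE /GRing.scale/=; ring.
Qed.

HB.instance Definition _ := GRing.isSubmodClosed.Build R cochain1
  exact_form (GRing.submod_closed_semi exact_form_submod).

Lemma exact_formZ a (w : cochain1) : w \in exact_form -> a *: w \in exact_form.
Proof. exact: rpredZ. Qed.

Definition cohomology1 : Type := @Quotient.quot cochain1 exact_form.
HB.instance Definition _ := EqQuotient.on cohomology1.
HB.instance Definition _ := GRing.Zmodule.on cohomology1.
HB.instance Definition _ := GRing.Zmodule_isLmodule.Build R cohomology1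
  (quot_scaleA exact_formZ) (quot_scale1 exact_formZ)
  (quot_scaleDr exact_formZ) (quot_scaleDl exact_formZ).
Definition cohom_class (w : cochain1) : cohomology1 := \pi_cohomology1 w.

Definition pairing (w : cochain1) (x : chain1) : R :=
  extend (w : edge G -> R^o) (repr x).

Lemma pairing_pi (w : cochain1) (x : edge_space) :
  pairing w (\pi_chain1 x) = extend (w : edge G -> R^o) x.
Proof. by apply: quot_lift => y; apply: extend0; exact: cochain1N. Qed.

Lemma pairing_edge (w : cochain1) e : pairing w (edge_chain e) = w e.
Proof. by rewrite /edge_chain pairing_pi extend_edge. Qed.

(* Independent of the representative when [h] is a cycle, see
   [cohom_pairing_class]. *)
Definition cohom_pairing (c : cohomology1) (h : chain1) : R :=
  pairing (repr c) h.

Lemma vertex_chain_sum (g : cochain0) v :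
  \sum_w (vertex_chain v w : R) * g w = g v.
Proof.
rewrite (bigD1 v)//= big1 => [|w wv]; rewrite ffunE.
  by rewrite eqxx mul1r addr0.
by rewrite (negbTE wv) mul0r.
Qed.

Lemma pairing_exact (g : cochain0) (h : chain1) :
  homology1 h -> pairing (differential g) h = 0.
Proof.
rewrite /homology1/= /boundary /pairing => /ffunP h0.
have -> : extend (differential g : edge G -> R^o) (repr h) =
    \sum_v (extend (fun e => vertex_chain (target e) -
      vertex_chain (origin e)) (repr h) v : R) * g v.
  rewrite /extend.
  under [RHS]eq_bigr => v _ do rewrite sum_ffunE mulr_suml.
  rewrite exchange_big/=; apply: eq_bigr => e _.
  rewrite ffunE -(vertex_chain_sum g (target e)) -(vertex_chain_sum g (origin e)).
  rewrite -sumrB scaler_sumr; apply: eq_bigr => v _.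
  by rewrite !ffunE -mulrBl scalerAl.
by rewrite big1// => v _; rewrite h0 ffunE mul0r.
Qed.

Lemma cohom_pairing_class (w : cochain1) (h : chain1) :
  homology1 h -> cohom_pairing (cohom_class w) h = pairing w h.
Proof.
move=> hh; apply/eqP; rewrite -subr_eq0.
have /asboolP[g gE] : repr (cohom_class w) - w \in exact_form.
  by apply/quot_eqP; rewrite reprK.
rewrite -(pairing_exact g hh) -gE /cohom_pairing /pairing /extend -sumrB.
by apply/eqP/eq_bigr => e _; rewrite !ffunE scalerBr.
Qed.

End Homology.

Section TangentBundle.
Variables (R : realType) (G : graph).
Implicit Types e f : edge G.
Local Open Scope quotient_scope.

(* Before gluing the two halflines [e] and [opp e] at their origins. *)
Definition halflines := (edge G * {nonneg R})%type.

Definition glue : rel halflines := fun x y =>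
  (x == y) || [&& x.1 == opp y.1, x.2%:num == 0 & y.2%:num == 0].

Lemma glue_equiv : equiv_class_of glue.
Proof.
split=> [x|x y|y x z]; rewrite /glue.
- by rewrite eqxx.
- by rewrite eq_sym [y.1 == _]eq_sym opp_swap [(x.2%:num == _) && _]andbC.
- case/orP => [/eqP->//|/and3P[/eqP xy x0 y0]].
  case/orP => [/eqP<-|/and3P[/eqP yz _ z0]]; first by rewrite xy eqxx x0 y0 orbT.
  apply/orP; left; case: x z xy x0 yz z0 => [x r] [z s]/= -> /eqP r0 -> /eqP s0.
  by rewrite oppK xpair_eqE eqxx/= -(inj_eq val_inj)/= r0 s0.
Qed.

Canonical glue_equivRel := EquivRelPack glue_equiv.

Definition TG : Type := {eq_quot glue}.
HB.instance Definition _ := EqQuotient.on TG.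
HB.instance Definition _ := Choice.on TG.

Definition tpoint e (q : {nonneg R}) : TG := \pi_TG (e, q).

Lemma tpoint0 e : tpoint e 0%:nng = tpoint (opp e) 0%:nng.
Proof. by apply/eqP; rewrite piE /= /glue/= oppK !eqxx orbT. Qed.

Definition tedge (x : TG) : edge G := (repr x).1.
Definition tspeed (x : TG) : R := (repr x).2%:num.

Definition halfline_dist (x y : halflines) : R :=
  if x.1 == y.1 then `|x.2%:num - y.2%:num|
  else if x.1 == opp y.1 then x.2%:num + y.2%:num
  else x.2%:num + y.2%:num + 1.

Lemma halfline_distC x y : halfline_dist x y = halfline_dist y x.
Proof.
rewrite /halfline_dist [y.1 == x.1]eq_sym [y.1 == opp _]eq_sym opp_swap.
by rewrite distrC [y.2%:num + x.2%:num]addrC.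
Qed.

Lemma halfline_dist_glue x x' y :
  glue x x' -> halfline_dist x y = halfline_dist x' y.
Proof.
rewrite /glue /halfline_dist => /orP[/eqP->//|/and3P[/eqP -> /eqP -> /eqP ->]].
rewrite opp_swap (inj_eq (@opp_inj G)).
have [->|xy] := eqVneq x'.1 y.1; last first.
  by case: eqP => _; rewrite !add0r ?sub0r ?normrN// ger0_norm.
rewrite [y.1 == opp _]eq_sym (negbTE (opp_neq _)).
by rewrite add0r sub0r normrN ger0_norm.
Qed.

Lemma halfline_dist0 x y : halfline_dist x y = 0 -> glue x y.
Proof.
case: x y => [e q] [f r]; rewrite /glue /halfline_dist/= xpair_eqE/=.
have q0 : 0 <= q%:num by []. have r0 : 0 <= r%:num by [].
case: eqP => [_ /normr0_eq0/eqP|_].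
  by rewrite subr_eq0 => /eqP/val_inj ->; rewrite eqxx.
case: eqP => _ /= qr; last by exfalso; move: q0 r0 qr; lra.
by apply/andP; split; apply/eqP; lra.
Qed.

Lemma halfline_dist_triangle y x z :
  halfline_dist x z <= halfline_dist x y + halfline_dist y z.
Proof.
case: x y z => [e q] [f r] [g s]; rewrite /halfline_dist/=.
have q0 : 0 <= q%:num by []. have r0 : 0 <= r%:num by [].
have s0 : 0 <= s%:num by [].
move: (q%:num) (r%:num) (s%:num) q0 r0 s0 => {}q {}r {}s q0 r0 s0.
have Hqr : q - r <= `|q - r| /\ r - q <= `|q - r|.
  by split; [|rewrite distrC]; exact: ler_norm.
have Hrs : r - s <= `|r - s| /\ s - r <= `|r - s|.
  by split; [|rewrite distrC]; exact: ler_norm.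
have Hqs : `|q - s| <= q + s by rewrite ler_norml; apply/andP; split; lra.
have Hqs' : `|q - s| <= `|q - r| + `|r - s|.
  by rewrite -(subrKA r) ler_normD.
have [->|ef] := eqVneq e f.
  by case: eqP => _; [lra|case: eqP => _; lra].
have [<-|fg] := eqVneq f g.
  by rewrite (negbTE ef); case: eqP => _; lra.
have [ef'|ef'] := eqVneq e (opp f).
  have [fg'|fg'] := eqVneq f (opp g).
    by rewrite ef' fg' oppK eqxx; lra.
  by do 2?[case: eqP => _]; lra.
by do 3?[case: eqP => _]; lra.
Qed.

Definition tdist (x y : TG) : R := halfline_dist (repr x) (repr y).

Lemma tdist_pi x y : tdist (\pi_TG x) (\pi_TG y) = halfline_dist x y.
Proof.
have gl z : glue (repr (\pi_TG z)) z by have := reprK (\pi_TG z) => /eqmodP.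
rewrite /tdist (halfline_dist_glue _ (gl x)) halfline_distC.
by rewrite (halfline_dist_glue _ (gl y)) halfline_distC.
Qed.

Lemma tdistxx x : tdist x x = 0.
Proof. by rewrite /tdist /halfline_dist eqxx subrr normr0. Qed.

Lemma tdist_positivity x y : tdist x y = 0 -> x = y.
Proof.
move/halfline_dist0 => xy; rewrite -[x]reprK -[y]reprK.
exact/eqmodP.
Qed.

HB.instance Definition _ := isMetric.Build R TG tdistxx tdist_positivity
  (fun x y => halfline_distC (repr x) (repr y))
  (fun y x z => halfline_dist_triangle (repr y) (repr x) (repr z)).

Definition edge0 : edge G := enum_val (Ordinal (edge_gt0 G)).
HB.instance Definition _ := isPointed.Build TG (tpoint edge0 0%:nng).

HB.instance Definition _ := @isMeasurable.Build (sigma_display (@open TG)) TG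
  <<s (@open TG) >> (@sigma_algebra0 _ setT _)
  (@sigma_algebraC (g_sigma_algebraType (@open TG)) _) (@sigma_algebra_bigcup _ setT _).

Lemma tspeed_tpoint e q : tspeed (tpoint e q) = q%:num.
Proof.
have /eqmodP : \pi_TG (repr (tpoint e q)) = \pi_TG (e, q) by rewrite reprK.
by rewrite /= /glue /tspeed => /orP[/eqP->//|/and3P[_ /eqP-> /eqP/= ->]].
Qed.

Lemma tpoint_repr x : exists q, x = tpoint (tedge x) q /\ q%:num = tspeed x.
Proof.
by exists (repr x).2; rewrite /tpoint /tedge -surjective_pairing reprK.
Qed.

Definition halfline e : set TG := [set tpoint e q | q in [set: {nonneg R}]].

Definition pi_E (x : TG) : set (edge G) :=
  if tspeed x == 0 then [set tedge x; opp (tedge x)] else [set tedge x].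

Lemma pi_E0 e : pi_E (tpoint e 0%:nng) = [set e; opp e].
Proof.
rewrite /pi_E tspeed_tpoint eqxx.
have /eqmodP : \pi_TG (repr (tpoint e 0%:nng)) = \pi_TG (e, 0%:nng).
  by rewrite reprK.
rewrite /= /glue /tedge => /orP[/eqP->//|/and3P[/eqP-> _ _]/=].
by rewrite oppK setUC.
Qed.

Lemma pi_E_gt0 e q : 0 < q%:num -> pi_E (tpoint e q) = [set e].
Proof.
move=> q0; rewrite /pi_E tspeed_tpoint gt_eqF//.
have /eqmodP : \pi_TG (repr (tpoint e q)) = \pi_TG (e, q) by rewrite reprK.
rewrite /= /glue /tedge => /orP[/eqP->//|/and3P[_ _ /eqP/= qE]].
by rewrite qE ltxx in q0.
Qed.

Definition pi_E_injective_on (A : set TG) :=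
  forall x y, A x -> A y -> x <> y -> pi_E x `&` pi_E y = set0.

End TangentBundle.

Section Measures.
Variables (R : realType) (G : graph).
Local Notation TG := (TG R G).

Definition finite_moment_measures : set (probability TG R) :=
  [set mu | (\int[mu]_x (tspeed x)%:E < +oo)%E].

Definition rotation (mu : probability TG R) : chain1 R G :=
  \sum_e (\int[mu]_(x in halfline e) tspeed x)%R *: edge_chain R e.

Definition form_integral (w : cochain1 R G) (mu : probability TG R) : R :=
  pairing w (rotation mu).

Definition closed_measures : set (probability TG R) :=
  [set mu | finite_moment_measures mu /\
    forall g : cochain0 R G, form_integral (differential g) mu = 0].

Definition supp (mu : probability TG R) : set TG :=
  [set x | forall U, open_nbhs x U -> (0 < mu U)%E].

End Measures.

Definition strictly_convex (R : realType) (f : R -> R) :=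
  forall x y t, x != y -> 0 < t < 1 ->
    f (t * x + (1 - t) * y) < t * f x + (1 - t) * f y.

Record hamiltonian (R : realType) (G : graph) (H : edge G -> R -> R) : Prop := {
  hamiltonian_opp : forall e p, H e p = H (opp e) (- p);
  hamiltonian_convex : forall e, strictly_convex (H e);
  hamiltonian_derivable : forall e p, derivable (H e) p 1;
  hamiltonian_superlinear_pinfty : forall e,
    H e p / `|p| @[p --> +oo] --> +oo;
  hamiltonian_superlinear_ninfty : forall e,
    H e p / `|p| @[p --> -oo] --> +oo
}.

Section Mather.
Variables (R : realType) (G : graph) (H : edge G -> R -> R).
Local Notation TG := (TG R G).

Definition legendre (e : edge G) (q : R) : R :=
  sup [set p * q - H e p | p in [set: R]].

Definition lagrangian (x : TG) : R := legendre (tedge x) (tspeed x).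

Definition lagrangian_form (w : cochain1 R G) (x : TG) : R :=
  lagrangian x - tspeed x * w (tedge x).

Hypothesis HH : hamiltonian H.

Lemma legendre_opp0 e : legendre (opp e) 0 = legendre e 0.
Proof.
rewrite /legendre; congr sup; apply/seteqP; split=> y [p _ <-]; exists (- p) => //.
  by rewrite !mulr0 (hamiltonian_opp HH e) opprK.
by rewrite !mulr0 (hamiltonian_opp HH e).
Qed.

Lemma lagrangian_tpoint e q : lagrangian (tpoint e q) = legendre e q%:num.
Proof.
have /eqmodP : \pi_TG%qT (repr (tpoint e q)) = \pi_TG%qT (e, q) by rewrite reprK.
rewrite /lagrangian tspeed_tpoint /tedge.
rewrite /= /glue => /orP[/eqP->//|/and3P[/eqP-> _ /eqP/= ->]].
exact: legendre_opp0.
Qed.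

Lemma lagrangian_form_tpoint w e q :
  lagrangian_form w (tpoint e q) = legendre e q%:num - q%:num * w e.
Proof.
have /eqmodP : \pi_TG%qT (repr (tpoint e q)) = \pi_TG%qT (e, q) by rewrite reprK.
rewrite /lagrangian_form lagrangian_tpoint tspeed_tpoint /tedge.
rewrite /= /glue => /orP[/eqP->//|/and3P[_ _ /eqP/= ->]].
by rewrite !mul0r.
Qed.

Local Open Scope ereal_scope.

(* The minimum defining [beta] and the maximum defining [alpha] are taken as
   infimum and supremum in the extended reals. *)
Definition beta (h : chain1 R G) : \bar R :=
  ereal_inf [set \int[mu]_x (lagrangian x)%:E | mu in
    [set mu | closed_measures mu /\ rotation mu = h]].

Definition alpha (c : cohomology1 R G) : \bar R :=
  ereal_sup [set (cohom_pairing c h)%:E - beta h | h in @homology1 R G].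

Definition minimizing_rotation (h : chain1 R G) : set (probability TG R) :=
  [set mu | [/\ closed_measures mu, rotation mu = h &
    \int[mu]_x (lagrangian x)%:E = beta h]].

Definition minimizing_class (c : cohomology1 R G) : set (probability TG R) :=
  [set mu | closed_measures mu /\ forall w, cohom_class w = c ->
    \int[mu]_x (lagrangian_form w x)%:E = - alpha c].

Definition mather_rotation (h : chain1 R G) : set TG :=
  \bigcup_(mu in minimizing_rotation h) supp mu.

Definition mather_class (c : cohomology1 R G) : set TG :=
  \bigcup_(mu in minimizing_class c) supp mu.

End Mather.

(* Main.v *)
Require Import Defs.
From HB Require Import structures.
From mathcomp Require Import all_boot all_order all_algebra.
From mathcomp Require Import all_classical all_reals all_analysis.
From mathcomp Require Import measurable_realfun.
From mathcomp Require Import ring lra.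
Set Implicit Arguments.
Unset Strict Implicit.
Unset Printing Implicit Defensive.
Import Order.TTheory GRing.Theory Num.Theory.
Import numFieldNormedType.Exports.

Local Open Scope classical_set_scope.
Local Open Scope ring_scope.

(** Moving the part of [mu] carried by each halfline to its barycenter keeps the
    rotation vector and, the Lagrangian being strictly convex in the speed, lowers
    the action unless each part was already a point mass. A minimizer therefore
    has a single speed on each halfline. The midpoint of two minimizers is again a
    minimizer, so two minimizers have the same speed on each halfline. *)

(** * The Legendre transform of a Hamiltonian *)

Section Legendre.
Variables (R : realType) (G : graph) (H : edge G -> R -> R).
Hypothesis HH : hamiltonian H.
Implicit Types (e : edge G) (p q : R).

(** Merges the growth at both ends; this confines the maximizers of [p * q - H e p] to a bounded
    interval. *)
Lemma hamiltonian_superlinear e (K : R) :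
  exists2 A : R, 0 < A & forall p, A < `|p| -> K * `|p| <= H e p.
Proof.
have /cvgryPge/(_ K)[A [_ HA]] := @hamiltonian_superlinear_pinfty _ _ _ HH e.
have /cvgryPge/(_ K)[B [_ HB]] := @hamiltonian_superlinear_ninfty _ _ _ HH e.
exists (1 + `|A| + `|B|) => [|p]; first by rewrite -addrA ltr_pwDl.
have A0 := ler_norm A; have B0 := lerNnormlW (lexx `|B|).
have A1 := normr_ge0 A; have B1 := normr_ge0 B.
case: (ltgtP p 0) => [p0|p0|->]; last by rewrite normr0; lra.
- rewrite (ltr0_norm p0) => pAB; rewrite -ler_pdivlMr ?oppr_gt0//.
  by rewrite -(ltr0_norm p0); apply: HB; lra.
- rewrite (gtr0_norm p0) => pAB; rewrite -ler_pdivlMr//.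
  by rewrite -{2}(gtr0_norm p0); apply: HA; lra.
Qed.

Lemma legendre_attained e q :
  exists p, forall p', p' * q - H e p' <= p * q - H e p.
Proof.
have [A A0 HA] := hamiltonian_superlinear e (`|q| + 1).
(* For [|p'| > B], growth with slope [|q| + 1] gives [p' * q - H e p' <= - |p'| <= - H e 0], the
   value at [0], so a maximum over [[-B, B]] is global. *)
pose B := A + `|H e 0|; have B0 : 0 <= B by rewrite addr_ge0// ltW.
have [] := @EVT_max R (fun p => p * q - H e p) (- B) B; first by lra.
  apply: derivable_within_continuous => p _; apply: derivableB => //.
  exact: hamiltonian_derivable HH _ _.
move=> p _ pmax; exists p => p'.
have [p'B|Bp'] := leP `|p'| B; first by apply: pmax; rewrite in_itv/= -ler_norml.
apply: (@le_trans _ _ (0 * q - H e 0)); last first.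
  by apply: pmax; rewrite in_itv/= oppr_le0 B0.
have : A < `|p'| by rewrite (le_lt_trans _ Bp')// /B lerDl.
move/HA; have := ler_norm (p' * q); rewrite normrM.
by have := ler_norm (H e 0); rewrite /B in Bp'; nra.
Qed.

(** A maximizer makes the set under [sup] bounded, without which [sup] would be a default value. *)
Lemma legendreE e p q : (forall p', p' * q - H e p' <= p * q - H e p) ->
  legendre H e q = p * q - H e p.
Proof.
move=> pmax; apply/eqP; rewrite eq_le; apply/andP; split.
  by apply: ge_sup => [|_ [p' _ <-]//]; exists (p * q - H e p), p.
by apply: ub_le_sup; [exists (p * q - H e p) => _ [p' _ <-]|exists p].
Qed.

Lemma fenchel_young e p q : p * q - H e p <= legendre H e q.
Proof. by have [p' p'max] := legendre_attained e q; rewrite (legendreE p'max). Qed.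

(* Differentiability of [H e] makes [legendre H e] strictly convex: a line of
   slope [p] touches it only at [q = 'D_1 (H e) p]. *)
Lemma legendre_tangent e q0 : exists p, forall q,
  legendre H e q0 + p * (q - q0) <= legendre H e q ?= iff (q == q0).
Proof.
have [p pmax] := legendre_attained e q0.
have L0 := legendreE pmax; exists p => q; rewrite L0.
have -> : p * q0 - H e p + p * (q - q0) = p * q - H e p by ring.
split; first exact: fenchel_young.
apply/eqP/eqP => [Lq|->]; last by rewrite L0.
(* First-order condition: if [p] is a maximizer for the speed [q'], then [q'] is the derivative of
   [H e] at [p]. Equality at [q] makes [p] a maximizer for both [q] and [q0], so they agree. *)
have slope q' : (forall p', p' * q' - H e p' <= p * q' - H e p) -> 'D_1 (H e) p = q'.
  move=> p'max; have dH p' : derivable (H e) p' 1 by apply: hamiltonian_derivable HH _ _.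
  have : is_derive p 1%R (fun p' => p' * q' - H e p') 0.
    apply: (@derive1_at_max _ _ (p - 1) (p + 1)) => [|t _||t _]; last exact: p'max.
    - lra.
    - by apply: derivableB.
    - by rewrite in_itv/=; lra.
  have dM : is_derive p 1 (fun p' : R => p' * q') q'.
    by apply: is_derive_eq; rewrite scaler0 add0r /GRing.scale/= mulr1.
  have dB : is_derive p 1 (fun p' => p' * q' - H e p') (q' - 'D_1 (H e) p).
    by apply: is_deriveB; exact/derivableP.
  by move=> /@derive_val; rewrite derive_val => /eqP; rewrite subr_eq0 => /eqP.
rewrite -(slope q0)// -[LHS](slope q)// => p'.
by rewrite Lq fenchel_young.
Qed.

(** A supremum of affine functions is lower semicontinuous: near [q], the affine function optimal at
    [q] stays above [a]. *)
Lemma measurable_legendre e : measurable_fun setT (legendre H e).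
Proof.
apply/measurable_EFinP; apply: lower_semicontinuous_measurable => q a.
have [p pmax] := legendre_attained e q.
rewrite /= lte_fin (legendreE pmax) => ap.
exists [set q' | a < p * q' - H e p].
  have : (fun q' => p * q' - H e p) q' @[q' --> q] --> p * q - H e p.
    by apply: cvgB; [apply: cvgM; [exact: cvg_cst|exact: cvg_id]|exact: cvg_cst].
  by move/cvgr_gt => /(_ _ ap).
by move=> q' /= aq; rewrite lte_fin (lt_le_trans aq)// fenchel_young.
Qed.

End Legendre.

(** * Topology and Borel sets of the tangent bundle *)

Section TangentBundle.
Variables (R : realType) (G : graph).
Local Notation TG := (TG R G).
Implicit Types (e f : edge G) (x y : TG) (q : {nonneg R}).

Lemma tspeed_ge0 x : 0 <= tspeed x.
Proof. by rewrite /tspeed. Qed.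

Lemma halfline_tpoint e q : halfline e (tpoint e q).
Proof. by exists q. Qed.

Lemma halfline_tedge x : halfline (tedge x) x.
Proof. by have [q [xq _]] := tpoint_repr x; exists q => //; exact: esym. Qed.

Lemma halfline_eq e x y : halfline e x -> halfline e y -> tspeed x = tspeed y -> x = y.
Proof.
by move=> [q _ <-] [r _ <-]; rewrite !tspeed_tpoint => /val_inj ->.
Qed.

Lemma tdist_tpoint e f (q r : {nonneg R}) :
  tdist (tpoint e q) (tpoint f r) = halfline_dist (e, q) (f, r).
Proof. exact: tdist_pi. Qed.

Lemma halfline_tpointE e f q :
  halfline e (tpoint f q) <-> f = e \/ f = Defs.opp e /\ q%:num = 0.
Proof.
split=> [[r _]|[->|[->]]]; last 2 first.
- exact: halfline_tpoint.
- move=> q0; exists 0%:nng => //.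
  by rewrite tpoint0; congr tpoint; apply: val_inj; rewrite /= q0.
(* The vanishing distance turns equality of points of the quotient into the gluing relation. *)
move=> fq; have := tdistxx (tpoint f q); rewrite -{1}fq tdist_tpoint.
move=> /halfline_dist0; rewrite /glue => /orP[/eqP[-> _]|]; first by left.
by move=> /and3P[/= /eqP-> _ /eqP q0]; rewrite oppK; right.
Qed.

Lemma halfline_tspeed_gt0 e f x :
  0 < tspeed x -> halfline e x -> halfline f x -> e = f.
Proof.
move=> x0 ex [q _ qx]; move: x0 ex; rewrite -{}qx tspeed_tpoint.
by move=> q0 /halfline_tpointE[//|[_ q0']]; rewrite q0' ltxx in q0.
Qed.

Lemma closed_halfline e : closed (halfline e : set TG).
Proof.
move=> x xcl; have [q [xq _]] := tpoint_repr x; apply: contrapT => nex.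
have : ~ (tedge x = e \/ tedge x = Defs.opp e /\ q%:num = 0).
  by move/halfline_tpointE; rewrite -xq.
move=> /not_orP[xe xe'].
have q0 : 0 <= q%:num by [].
(* The ball of radius [r] about [x] misses [halfline e]: the distance is at least the speed [q] of
   [x] on the opposite halfline, and at least [1] on the others. *)
pose r : R := if tedge x == Defs.opp e then q%:num else 1.
have r0 : 0 < r.
  rewrite /r; case: eqP => [xoe|//]; rewrite lt_def q0 andbT; apply/eqP => q0'.
  exact: xe'.
have [y [[s _ <-]]] := xcl _ (nbhsx_ballx x r r0).
rewrite ballEmdist/= xq [mdist _ _]tdist_tpoint /halfline_dist/=.
have s0 : 0 <= s%:num by [].
rewrite (negbTE (introN eqP xe)) /r; case: eqP => _; lra.
Qed.

Lemma measurable_open (A : set TG) : open A -> measurable A.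
Proof. exact: sub_sigma_algebra. Qed.

Lemma measurable_closed (A : set TG) : closed A -> measurable A.
Proof.
by move=> cA; rewrite -[A]setCK; apply: measurableC; apply: measurable_open; exact: closed_openC.
Qed.

Lemma measurable_halfline e : measurable (halfline e : set TG).
Proof. by apply: measurable_closed; exact: closed_halfline. Qed.

Lemma accessible_TG : accessible_space TG.
Proof. by apply: hausdorff_accessible; exact: metric_hausdorff. Qed.

Lemma measurable_TG1 x : measurable [set x].
Proof. by apply: measurable_closed; apply: accessible_closed_set1; exact: accessible_TG. Qed.

Lemma tspeed_lipschitz x y : `|tspeed x - tspeed y| <= tdist x y.
Proof.
rewrite /tdist /halfline_dist /tspeed.
case: (repr x) (repr y) => [e q] [f r] /=.
have q0 : 0 <= q%:num by []. have r0 : 0 <= r%:num by [].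
have qr : `|q%:num - r%:num| <= q%:num + r%:num by rewrite ler_norml; apply/andP; split; lra.
by case: ifP => // _; case: ifP => // _; rewrite (le_trans qr)// lerDl.
Qed.

Lemma continuous_tspeed : continuous (@tspeed R G).
Proof.
move=> x; apply/(@cvgrPdist_lt _ _ _ (nbhs (x : TG))) => r r0.
apply/nbhs_ballP; exists r => // y; rewrite ballEmdist/=.
exact: le_lt_trans (tspeed_lipschitz x y).
Qed.

Lemma measurable_tspeed : measurable_fun setT (@tspeed R G).
Proof.
apply: measurability (RGenOpens.measurableE R) _ => _ [_ [a [b ->] <-]].
rewrite setTI; apply: measurable_open.
by move/continuousP : continuous_tspeed; apply; exact: interval_open.
Qed.

End TangentBundle.

(** * Measurable choice of an edge through each point *)

Section Selection.
Variables (R : realType) (G : graph).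
Local Notation TG := (TG R G).
Implicit Types (e f : edge G) (x y : TG).

(** Halflines overlap at their origins; the fibres of a selection are disjoint, so that integrals
    split into sums over edges. *)
Definition edge_selection (s : TG -> edge G) :=
  (forall x, halfline (s x) x) /\ (forall f, measurable (s @^-1` [set f])).

(** Although [tedge] depends on the arbitrary choice made by [repr], its fibre over [f] differs from
    the closed set [halfline f] at most by the origin. *)
Lemma measurable_tedge f : measurable (@tedge R G @^-1` [set f]).
Proof.
have [z z0] : exists z : {nonneg R}, z%:num = 0 by exists 0%:nng.
pose Z : set TG := [set tpoint f z].
have -> : @tedge R G @^-1` [set f] =
    (halfline f `\` Z) `|` (Z `&` [set x | tedge (tpoint f z) = f]).
  apply/seteqP; split=> x /=.
    move=> xf; have xh : halfline f x by rewrite -xf; exact: halfline_tedge.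
    have [xZ|xZ] := pselect (Z x); [right; split=> //|by left].
    by rewrite -[tpoint _ _]xZ.
  case=> [[xf xZ]|[-> //]].
  apply: (@halfline_tspeed_gt0 _ _ _ _ x) => //; last exact: halfline_tedge.
  rewrite lt_def tspeed_ge0 andbT; apply/eqP => x0; apply: xZ.
  apply: (halfline_eq xf); first exact: halfline_tpoint.
  by rewrite x0 tspeed_tpoint z0.
apply: measurableU.
  by apply: measurableD; [exact: measurable_halfline|exact: measurable_TG1].
have [->|zf] := pselect ([set _ : TG | tedge (tpoint f z) = f] = setT).
  by rewrite setIT; exact: measurable_TG1.
rewrite (_ : _ `&` _ = set0)//; apply/seteqP; split=> // x [_ /= xf].
by apply: zf; apply/seteqP; split.
Qed.

(* At a vertex [tedge] picks one of the two edges arbitrarily; [sel] makes [e] the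
   preferred choice. *)
Definition sel e x : edge G := if `[< halfline e x >] then e else tedge x.

Lemma sel_halfline e x : halfline e x -> sel e x = e.
Proof. by rewrite /sel => ex; rewrite asboolT. Qed.

Lemma selection_sel e : edge_selection (sel e).
Proof.
split=> [x|f].
  by rewrite /sel; case: asboolP => // _; exact: halfline_tedge.
have [<-|ef] := eqVneq e f.
  rewrite (_ : _ @^-1` _ = halfline e); first exact: measurable_halfline.
  apply/seteqP; split=> x /=; last exact: sel_halfline.
  by rewrite /sel; case: asboolP => // _ <-; exact: halfline_tedge.
rewrite (_ : _ @^-1` _ = (@tedge R G @^-1` [set f]) `\` halfline e).
  by apply: measurableD; [exact: measurable_tedge|exact: measurable_halfline].
apply/seteqP; split=> x /=; rewrite /sel; case: asboolP => //.
- by move=> _ /eqP; rewrite (negbTE ef).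
- by move=> ? [].
- by move=> _ [].
Qed.

Variable s : TG -> edge G.
Hypothesis hs : edge_selection s.

Lemma selection_tpoint x : exists2 q, x = tpoint (s x) q & q%:num = tspeed x.
Proof. by have [q _ xq] := hs.1 x; exists q; rewrite -xq ?tspeed_tpoint// xq. Qed.

Lemma selection_cover : \big[setU/set0]_(f <- enum (edge G)) (s @^-1` [set f]) = setT.
Proof.
apply/seteqP; split=> // x _; rewrite -bigcup_seq.
by exists (s x) => //=; rewrite mem_enum.
Qed.

Lemma selection_trivIset (D : set (edge G)) : trivIset D (fun f => s @^-1` [set f]).
Proof. by move=> f g _ _ [x [/= <- <-]]. Qed.

Lemma measurable_selection d (T : measurableType d) (g : edge G -> R -> T) :
  (forall f, measurable_fun setT (g f)) ->
  measurable_fun setT (fun x => g (s x) (tspeed x)).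
Proof.
move=> mg _ Y mY; rewrite setTI.
rewrite (_ : _ @^-1` Y = \bigcup_(f in [set: edge G])
    ((s @^-1` [set f]) `&` ((g f \o @tspeed R G) @^-1` Y))).
  apply: fin_bigcup_measurable => // f _; apply: measurableI; first exact: hs.2.
  rewrite -[X in measurable X]setTI.
  by apply: measurableT_comp => //; exact: measurable_tspeed.
apply/seteqP; split=> [x Yx|x [f _ [/= <- //]]].
by exists (s x).
Qed.

Lemma integral_selection (mu : {measure set TG -> \bar R}) (g : edge G -> R -> R) :
  (forall f, measurable_fun setT (g f)) ->
  (\int[mu]_x (g (s x) (tspeed x))%:E =
   \sum_(f <- enum (edge G)) \int[mu]_(x in s @^-1` [set f]) (g f (tspeed x))%:E)%E.
Proof.
move=> mg; rewrite -selection_cover integral_bigsetU_EFin/=.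
- by apply: eq_bigr => f _; apply: eq_integral => x; rewrite inE/= => ->.
- by move=> f; exact: hs.2.
- exact: enum_uniq.
- exact: selection_trivIset.
- rewrite selection_cover; apply/measurable_EFinP.
  exact: measurable_selection.
Qed.

(** The two domains differ at most at the origin, where the speed vanishes. Rotation vectors can
    thus be computed on disjoint pieces. *)
Lemma integral_halfline_selection (mu : {measure set TG -> \bar R}) e :
  (\int[mu]_(x in halfline e) (tspeed x)%:E =
   \int[mu]_(x in s @^-1` [set e]) (tspeed x)%:E)%E.
Proof.
rewrite integral_mkcond [RHS]integral_mkcond; apply: eq_integral => x _.
rewrite /patch; case: ifPn => [|]; case: ifPn => //; rewrite !inE/= => xs xe.
- congr EFin; apply/eqP; rewrite eq_le tspeed_ge0 andbT leNgt; apply: contraNN xs.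
  move=> x0; rewrite inE/=.
  exact: (halfline_tspeed_gt0 x0 (hs.1 x) xe).
- by exfalso; move/negP: xe; apply; rewrite inE -xs; exact: hs.1.
Qed.

End Selection.

(** * Integrability and almost everywhere equality from integral bounds *)

Section IntegralComparison.
Context d (T : measurableType d) (R : realType) (mu : {measure set T -> \bar R}).
Variables (f g : T -> R).
Hypothesis mf : measurable_fun setT f.
Hypothesis ig : mu.-integrable setT (EFin \o g).
Hypothesis gf : forall x, g x <= f x.

(** The negative part of [f] is dominated by that of [g]; once it has finite integral, the bound on
    the integral of [f] controls the positive part. *)
Lemma integrable_of_lower_bound :
  (\int[mu]_x (f x)%:E < +oo)%E -> mu.-integrable setT (EFin \o f).
Proof.
move=> fy; have mEf : measurable_fun setT (EFin \o f) by exact/measurable_EFinP.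
have neg : (\int[mu]_x (EFin \o f)^\- x < +oo)%E.
  apply: le_lt_trans (integral_funeneg_lt_pinfty measurableT ig).
  apply: ge0_le_integral => //; [exact: measurable_funeneg| |].
    by apply: measurable_funeneg; exact: measurable_int ig.
  by move=> x _; rewrite !funenegE/= ge_max le_max !lee_fin lerN2 gf le_max lexx !orbT.
apply/integrableP; split => //; rewrite -[X in integral _ _ X]/(abse \o (EFin \o f)) fune_abse.
rewrite ge0_integralD//; [|exact: measurable_funepos|exact: measurable_funeneg].
rewrite lte_add_pinfty//.
have : (\int[mu]_x (EFin \o f) x < +oo)%E := fy.
rewrite integralE; move: neg.
have : (0 <= \int[mu]_x (EFin \o f)^\- x)%E by exact: integral_ge0.
case: (\int[mu]_x _^\- x)%E => [r _ _||]//.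
by case: (\int[mu]_x (EFin \o f)^\+ x)%E => [s|/=|/=]; rewrite ?ltry ?ltNyr.
Qed.

(** The nonnegative function [f - g] has integral at most zero, hence vanishes almost everywhere. *)
Lemma ae_eq_of_integral_le :
  (\int[mu]_x (f x)%:E <= \int[mu]_x (g x)%:E)%E ->
  mu.-integrable setT (EFin \o f) /\ {ae mu, forall x, f x = g x}.
Proof.
move=> fg; have If : mu.-integrable setT (EFin \o f).
  by apply: integrable_of_lower_bound; rewrite (le_lt_trans fg)// integrable_lty.
split => //.
have Ifg := integrableB measurableT If ig.
have fg0 : (\int[mu]_x `|((EFin \o f) \- (EFin \o g)) x| = 0)%E.
  apply/eqP; rewrite eq_le integral_ge0// andbT.
  rewrite (eq_integral ((EFin \o f) \- (EFin \o g))%E); last first.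
    by move=> x _; rewrite /= ger0_norm// subr_ge0.
  rewrite integralB//=. by rewrite sube_le0.
have /(ae_eq_integral_abs mu measurableT (measurable_int mu Ifg)) := fg0.
by apply: filterS => x /(_ I) [] /eqP; rewrite subr_eq0 => /eqP.
Qed.

End IntegralComparison.

(** * Mean speed on a measurable piece *)

Section Barycenter.
Variables (R : realType) (G : graph).
Local Notation TG := (TG R G).
Variable mu : probability TG R.
Hypothesis fmu : finite_moment_measures mu.

Lemma integrable_tspeed (D : set TG) : measurable D ->
  mu.-integrable D (EFin \o @tspeed R G).
Proof.
move=> mD; apply: integrableS (subsetT D) _ => //.
apply/integrableP; split; first by apply/measurable_EFinP; exact: measurable_tspeed.
by under eq_integral do rewrite /= ger0_norm ?tspeed_ge0//.
Qed.

Lemma barycenter (D : set TG) : measurable D ->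
  exists b : {nonneg R}, (\int[mu]_(x in D) (tspeed x)%:E = b%:num%:E * mu D)%E.
Proof.
move=> mD; have [D0|D0] := eqVneq (mu D) 0%E.
  (* On a null piece any speed satisfies the product form; zero is a default. *)
  exists 0%:nng; rewrite D0 mule0 null_set_integral//.
  by apply/measurable_EFinP/measurable_funTS; exact: measurable_tspeed.
have fI := integrable_fin_num mD (integrable_tspeed mD).
have fD : mu D \is a fin_num by exact: fin_num_measure.
have b0 : 0 <= fine (\int[mu]_(x in D) (tspeed x)%:E) / fine (mu D).
  by rewrite divr_ge0// fine_ge0// integral_ge0// => x _; rewrite lee_fin tspeed_ge0.
exists (NngNum b0) => /=.
rewrite -[in RHS](fineK fD) -EFinM divfK; last by rewrite /= fine_eq0.
by rewrite fineK.
Qed.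

End Barycenter.

(** * The barycentric competitor and Jensen's inequality *)

Section Competitor.
Variables (R : realType) (G : graph) (H : edge G -> R -> R).
Hypothesis HH : hamiltonian H.
Local Notation TG := (TG R G).
Variable s : TG -> edge G.
Hypothesis hs : edge_selection s.

Lemma lagrangian_selection x : lagrangian H x = legendre H (s x) (tspeed x).
Proof.
have [q xq <-] := selection_tpoint hs x.
by rewrite {1}xq; exact: (lagrangian_tpoint HH).
Qed.

Lemma measurable_lagrangian_selection : measurable_fun setT (lagrangian H).
Proof.
rewrite (_ : lagrangian H = fun x => legendre H (s x) (tspeed x)).
  by apply: (measurable_selection hs) => f; exact: measurable_legendre.
by apply/funext => x; exact: lagrangian_selection.
Qed.

Lemma closed_measures_rotation (mu nu : probability TG R) :
  finite_moment_measures nu -> rotation nu = rotation mu ->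
  closed_measures mu -> closed_measures nu.
Proof. by move=> fnu nm [_ cmu]; split=> // g; rewrite /form_integral nm; exact: cmu. Qed.

Section Push.
Variables (mu : probability TG R) (b : edge G -> {nonneg R}).

Definition concentrate x : TG := tpoint (s x) (b (s x)).

Lemma measurable_concentrate : measurable_fun setT concentrate.
Proof.
by apply: (measurable_selection hs (g := fun f _ => tpoint f (b f))) => f; exact: measurable_cst.
Qed.

HB.instance Definition _ := isMeasurableFun.Build _ _ _ _ _ measurable_concentrate.
Definition concentrated : probability TG R := distribution mu concentrate.

(** [concentrate] takes at most one value per edge, so every measurable [u] is bounded along it. *)
Lemma integral_concentrated (u : TG -> R) : measurable_fun setT u ->
  concentrated.-integrable setT (EFin \o u) /\
  (\int[concentrated]_x (u x)%:E = \int[mu]_x (u (concentrate x))%:E)%E.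
Proof.
move=> u_meas; have Iu : mu.-integrable setT ((EFin \o u) \o concentrate).
  apply: measurable_bounded_integrable => //.
  - by rewrite -ge0_fin_numE// fin_num_measure.
  - by apply: measurableT_comp => //; exact: measurable_concentrate.
  - exists (\sum_f `|u (tpoint f (b f))|); split; first exact: num_real.
    move=> M uM x _ /=; apply: le_trans (ltW uM); rewrite /concentrate.
    by rewrite (bigD1 (s x))//= lerDl sumr_ge0.
have mEu : measurable_fun setT (EFin \o u) by exact/measurable_EFinP.
split; last by rewrite integral_distribution.
by apply: integrable_pushforward => //; exact: measurable_concentrate.
Qed.

Hypothesis hb : forall f,
  (\int[mu]_(x in s @^-1` [set f]) (tspeed x)%:E = (b f)%:num%:E * mu (s @^-1` [set f]))%E.

Lemma rotation_concentrated : rotation concentrated = rotation mu.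
Proof.
apply: eq_bigr => e _; congr (_ *: _); congr fine.
rewrite (integral_halfline_selection hs mu e) hb.
rewrite ge0_integral_pushforward//; last 3 first.
- exact: measurable_halfline.
- by apply: measurable_funTS; apply/measurable_EFinP; exact: measurable_tspeed.
- by move=> x _; rewrite lee_fin tspeed_ge0.
rewrite -(integral_cst mu (hs.2 e)) integral_mkcond.
rewrite [RHS]integral_mkcond; apply: eq_integral => x _; rewrite /patch.
case: ifPn => [|]; case: ifPn => //; rewrite !inE/= /concentrate ?tspeed_tpoint.
- by move=> ->.
(* A point of another piece can land on [halfline e] only at its origin, where it contributes zero
   speed. *)
- by move=> /negP; rewrite inE/= => se /halfline_tpointE[/se[]|[_ ->]].
- by move=> sx /negP; case; rewrite inE/= /concentrate sx; exact: halfline_tpoint.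
Qed.

End Push.

(** Jensen's inequality on each piece of the selection: a supporting line at the mean speed
    integrates to the action of the concentrated measure, and touches the Lagrangian at the mean
    speed only. *)
Lemma barycentric_competitor (mu : probability TG R) : closed_measures mu ->
  exists nu (b : edge G -> R), [/\ closed_measures nu, rotation nu = rotation mu,
    nu.-integrable setT (EFin \o lagrangian H) &
    (\int[mu]_x (lagrangian H x)%:E <= \int[nu]_x (lagrangian H x)%:E)%E ->
      mu.-integrable setT (EFin \o lagrangian H) /\
      {ae mu, forall x, tspeed x = b (s x)}].
Proof.
move=> cmu; have [fmu _] := cmu.
have /choice[b hb] f := barycenter fmu (hs.2 f).
have mL := measurable_lagrangian_selection.
have [IL iL] := integral_concentrated mu b mL.
have rot := rotation_concentrated hb.
exists (concentrated mu b), (fun f => (b f)%:num); split => //.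
  apply: closed_measures_rotation cmu => //.
  have [It _] := integral_concentrated mu b (@measurable_tspeed R G).
  exact: integrable_lty It.
rewrite iL => Lle.
have /choice[p hp] f := legendre_tangent HH f (b f)%:num.
(* The supporting line of [legendre H f] at the barycenter [b f]. *)
pose a f q := legendre H f (b f)%:num + p f * (q - (b f)%:num).
have ma f : measurable_fun setT (a f).
  by apply: measurable_funD => //; apply: measurable_funM => //; apply: measurable_funD.
(* With finitely many edges, the lines are jointly bounded by [C + P * tspeed x], which has finite
   integral by the moment condition. *)
have Ia : mu.-integrable setT (EFin \o (fun x => a (s x) (tspeed x))).
  pose C := \sum_f `|a f 0|; pose P := \sum_f `|p f|.
  apply: (@le_integrable _ _ _ _ setT _ _ (fun x => (C + P * tspeed x)%:E)) => //.
  - by apply/measurable_EFinP; exact: (measurable_selection hs).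
  - move=> x _; rewrite /= lee_fin.
    have P0 : 0 <= P by rewrite sumr_ge0.
    have C0 : 0 <= C by rewrite sumr_ge0.
    rewrite [leRHS]ger0_norm ?addr_ge0 ?mulr_ge0 ?tspeed_ge0//.
    rewrite (_ : a (s x) (tspeed x) = a (s x) 0 + p (s x) * tspeed x); last first.
      by rewrite /a; ring.
    rewrite (le_trans (ler_normD _ _))// lerD//.
      by rewrite /C (bigD1 (s x))//= lerDl sumr_ge0.
    rewrite normrM (ger0_norm (tspeed_ge0 x)) ler_wpM2r ?tspeed_ge0//.
    by rewrite /P (bigD1 (s x))//= lerDl sumr_ge0.
  - apply: (integrableD measurableT (f := EFin \o cst C)
        (g := fun x => (P%:E * (tspeed x)%:E)%E)).
      exact: finite_measure_integrable_cst.
    by apply: integrableZl => //; exact: integrable_tspeed.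
(* An affine function of the speed integrates over a piece to its value at the barycenter times the
   mass. *)
have aL : (\int[mu]_x (a (s x) (tspeed x))%:E =
    \int[mu]_x (lagrangian H (concentrate b x))%:E)%E.
  under [RHS]eq_integral => x _ do rewrite (lagrangian_tpoint HH).
  rewrite (integral_selection hs mu ma).
  rewrite (integral_selection hs mu (g := fun f _ => legendre H f (b f)%:num)); last first.
    by move=> f; exact: measurable_cst.
  apply: eq_bigr => f _; have mD := hs.2 f; have It := integrable_tspeed fmu mD.
  have fD : mu (s @^-1` [set f]) \is a fin_num by exact: fin_num_measure.
  set c := legendre H f _; set k := c - p f * (b f)%:num.
  rewrite (eq_integral ((EFin \o cst k) \+ (fun x => (p f)%:E * (tspeed x)%:E))%E); last first.
    by move=> x _; rewrite /a /= -EFinM -EFinD /k -/c; congr EFin; ring.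
  rewrite integralD//; last 2 first.
  - exact: finite_measure_integrable_cst.
  - exact: integrableZl.
  rewrite integralZl// hb (integral_cst mu mD k%:E) (integral_cst mu mD c%:E).
  have kE : k = c - p f * (b f)%:num by [].
  clearbody k; suff key (M : \bar R) : M \is a fin_num ->
      (k%:E * M + (p f)%:E * ((b f)%:num%:E * M) = c%:E * M)%E by exact: key.
  by case: M => // m _; rewrite -!EFinM -EFinD; congr EFin; rewrite kE; ring.
rewrite -aL in Lle.
have [|IL' aeL] := ae_eq_of_integral_le mL Ia _ Lle.
  by move=> x; rewrite lagrangian_selection; exact: (hp _ _).1.
split => //; apply: filterS aeL => x.
rewrite lagrangian_selection => /esym/eqP; rewrite (hp _ _).2 => /eqP; exact.
Qed.

End Competitor.

(** * Linearity of the pairing on chains *)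

Section Pairing.
Variables (R : realType) (G : graph).
Local Open Scope quotient_scope.

(** [repr] is not linear, so the combination of chains is rewritten as the class of a combination of
    representatives, on which [pairing_pi] applies. *)
Lemma pairing_linear (w : cochain1 R G) a (x y : chain1 R G) :
  pairing w (a *: x + y) = a * pairing w x + pairing w y.
Proof.
rewrite -[x]reprK -[y]reprK !pairing_pi.
have -> : a *: \pi_(chain1 R G) (repr x) = \pi_(chain1 R G) (a *: repr x).
  exact: (quot_piZ (@opp_relationsZ R G)).
have -> : \pi_(chain1 R G) (a *: repr x) + \pi_(chain1 R G) (repr y) =
    \pi_(chain1 R G) (a *: repr x + repr y).
  by rewrite raddfD.
by rewrite pairing_pi linearP.
Qed.

Lemma pairing0l (x : chain1 R G) : pairing 0 x = 0.
Proof. by rewrite /pairing /extend big1// => e _; rewrite ffunE scaler0. Qed.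

Lemma pairing0r (w : cochain1 R G) : pairing w 0 = 0.
Proof. by have := pairing_linear w (-1) 0 0; rewrite scaler0 add0r mulN1r addNr. Qed.

Lemma pairingZ (w : cochain1 R G) a (x : chain1 R G) :
  pairing w (a *: x) = a * pairing w x.
Proof. by rewrite -[a *: x]addr0 pairing_linear pairing0r addr0. Qed.

Lemma pairingD (w : cochain1 R G) (x y : chain1 R G) :
  pairing w (x + y) = pairing w x + pairing w y.
Proof. by rewrite -{1}[x]scale1r pairing_linear mul1r. Qed.

Lemma pairing_sum (w : cochain1 R G) (m : edge G -> R) :
  pairing w (\sum_e m e *: edge_chain R e) = \sum_e m e * w e.
Proof.
elim/big_rec2: _ => [|e r x _ <-]; first exact: pairing0r.
by rewrite pairing_linear pairing_edge.
Qed.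

End Pairing.

(** * The midpoint of two probability measures *)

Section Midpoint.
Variables (R : realType) (G : graph).
Local Notation TG := (TG R G).
Variables mu1 mu2 : probability TG R.

Definition midpoint : set TG -> \bar R :=
  mscale (2^-1)%:nng (measure_add mu1 mu2).
HB.instance Definition _ := Measure.on midpoint.

Lemma midpointE A : midpoint A = ((2^-1)%:E * (mu1 A + mu2 A))%E.
Proof. by congr (_ * _)%E; exact: measure_addE. Qed.

Fact midpoint_setT : midpoint setT = 1%E.
Proof.
rewrite midpointE !probability_setT -EFinD -EFinM.
by congr EFin; lra.
Qed.

HB.instance Definition _ := Measure_isProbability.Build _ _ _ midpoint midpoint_setT.

Lemma ge0_integral_midpoint (D : set TG) (f : TG -> \bar R) :
  measurable D -> measurable_fun D f -> (forall x, (0 <= f x)%E) ->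
  (\int[midpoint]_(x in D) f x =
   (2^-1)%:E * (\int[mu1]_(x in D) f x + \int[mu2]_(x in D) f x))%E.
Proof.
move=> mD mf f0; rewrite ge0_integral_mscale//=.
by rewrite ge0_integral_measure_add.
Qed.

Lemma integral_midpoint (f : TG -> \bar R) :
  mu1.-integrable setT f -> mu2.-integrable setT f ->
  (\int[midpoint]_x f x = (2^-1)%:E * (\int[mu1]_x f x + \int[mu2]_x f x))%E.
Proof.
move=> f1 f2; have mf := measurable_int _ f1.
rewrite integralE !ge0_integral_midpoint//; [|exact: measurable_funeneg|exact: measurable_funepos].
rewrite (integralE mu1 _ f) (integralE mu2 _ f).
(* Positive and negative parts are integrated separately; integrability makes all four values
   finite, so that they can be regrouped. *)
suff key (a b c e : \bar R) : a \is a fin_num -> b \is a fin_num ->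
    c \is a fin_num -> e \is a fin_num ->
    ((2^-1)%:E * (a + b) - (2^-1)%:E * (c + e) = (2^-1)%:E * ((a - c) + (b - e)))%E.
  by apply: key; apply: integrable_fin_num => //;
    (exact: integrable_funepos || exact: integrable_funeneg).
case: a b c e => // a [] // b [] // c [] // e _ _ _ _.
transitivity (2^-1 * (a + b) - 2^-1 * (c + e))%:E => //.
transitivity (2^-1 * ((a - c) + (b - e)))%:E => //.
by congr EFin; ring.
Qed.

Lemma supp_midpointl : supp mu1 `<=` supp midpoint.
Proof.
move=> x xs U xU; have := xs U xU => U0.
by rewrite [X in (_ < X)%E]midpointE mule_gt0// (lt_le_trans U0)// leeDl.
Qed.

Lemma supp_midpointr : supp mu2 `<=` supp midpoint.
Proof.
move=> x xs U xU; have := xs U xU => U0.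
by rewrite [X in (_ < X)%E]midpointE mule_gt0// (lt_le_trans U0)// leeDr.
Qed.

Hypotheses (c1 : closed_measures mu1) (c2 : closed_measures mu2).

Lemma rotation_midpoint :
  rotation midpoint = 2^-1 *: (rotation mu1 + rotation mu2).
Proof.
rewrite /rotation -big_split/= scaler_sumr; apply: eq_bigr => e _.
rewrite -scalerDl scalerA; congr (_ *: _).
rewrite /Rintegral ge0_integral_midpoint; [|exact: measurable_halfline| |]; last 2 first.
- by apply/measurable_EFinP/measurable_funTS; exact: measurable_tspeed.
- by move=> x; rewrite lee_fin tspeed_ge0.
have mE := @measurable_halfline R G e.
have f1 := integrable_fin_num mE (integrable_tspeed c1.1 mE).
have f2 := integrable_fin_num mE (integrable_tspeed c2.1 mE).
(* [fine] is additive on finite values; the finite moments of both measures provide these. *)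
suff key (a b : \bar R) : a \is a fin_num -> b \is a fin_num ->
    fine ((2^-1)%:E * (a + b))%E = 2^-1 * (fine a + fine b) by exact: key.
by case: a b => [a||] [b||].
Qed.

Lemma closed_midpoint : closed_measures midpoint.
Proof.
split.
  have i1 := integrable_fin_num measurableT (integrable_tspeed c1.1 measurableT).
  have i2 := integrable_fin_num measurableT (integrable_tspeed c2.1 measurableT).
  rewrite /finite_moment_measures/= ge0_integral_midpoint//.
  - by rewrite -(fineK i1) -(fineK i2) -EFinD -EFinM ltry.
  - by apply/measurable_EFinP; exact: measurable_tspeed.
  - by move=> x; rewrite lee_fin tspeed_ge0.
move=> g; have := c1.2 g; have := c2.2 g; rewrite /form_integral => e2 e1.
by rewrite rotation_midpoint pairingZ pairingD e1 e2 addr0 mulr0.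
Qed.

End Midpoint.

(** * Supports of minimizers and the graph property *)

Section Minimizers.
Variables (R : realType) (G : graph) (H : edge G -> R -> R).
Hypothesis HH : hamiltonian H.
Local Notation TG := (TG R G).
Implicit Types (e : edge G) (mu nu : probability TG R) (x y : TG).

(** Minimality at fixed rotation vector, the property common to both kinds of minimizers and to
    their midpoints. *)
Definition action_minimizing mu := closed_measures mu /\
  forall nu, closed_measures nu -> rotation nu = rotation mu ->
    (\int[mu]_x (lagrangian H x)%:E <= \int[nu]_x (lagrangian H x)%:E)%E.

Lemma measurable_lagrangian : measurable_fun setT (lagrangian H).
Proof.
apply: (measurable_lagrangian_selection HH (s := sel (edge0 G))).
exact: selection_sel.
Qed.

Lemma minimizing_integrable mu :
  action_minimizing mu -> mu.-integrable setT (EFin \o lagrangian H).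
Proof.
move=> [cmu mmu].
have [nu [b [cnu rnu _]]] := barycentric_competitor HH (@selection_sel R G (edge0 G)) cmu.
by move=> /(_ (mmu _ cnu rnu))[].
Qed.

(** The selection [sel e] assigns all of [halfline e], origin included, to [e], so mass at the
    vertex is also bound to the common speed. *)
Lemma minimizing_halfline mu e : action_minimizing mu ->
  exists b : R, {ae mu, forall x, halfline e x -> tspeed x = b}.
Proof.
move=> [cmu mmu].
have [nu [b [cnu rnu _]]] := barycentric_competitor HH (@selection_sel R G e) cmu.
move=> /(_ (mmu _ cnu rnu))[_ aeb]; exists (b e).
by apply: filterS aeb => x + xe; rewrite sel_halfline.
Qed.

(** The points having the prescribed speeds form a finite, hence closed, set; its complement is open
    and null, so it misses the support. *)
Lemma minimizing_supp mu : action_minimizing mu ->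
  exists b : edge G -> R, forall x, supp mu x ->
    forall e, halfline e x -> tspeed x = b e.
Proof.
move=> mmu; have /choice[b hb] e := minimizing_halfline e mmu.
exists b; pose C := [set x : TG | forall e, halfline e x -> tspeed x = b e].
have fC : finite_set C.
  pose S e := [set x : TG | halfline e x /\ tspeed x = b e].
  (* Each [S e] has at most one point, and [xget] picks it when it exists. *)
  apply: (@sub_finite_set _ _ ((fun e => xget point (S e)) @` [set: edge G])); last first.
    by apply: finite_image; exact: finite_finset.
  move=> x Cx.
  have Sx : S (tedge x) x by split; [|apply: Cx]; exact: halfline_tedge.
  exists (tedge x) => //; have [hx bx] := xgetI point Sx.
  by apply: (halfline_eq hx Sx.1); rewrite bx Sx.2.
have cC : closed C by have := @accessible_TG R G; rewrite accessible_finite_set_closed; exact.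
have aeC : mu.-negligible (~` C) by exact: filter_forall hb.
have C0 : mu (~` C) = 0%E.
  by apply: measure_negligible aeC; apply: measurable_open; exact: closed_openC.
move=> x xs; suff : C x by [].
apply: contrapT => xC; have := xs (~` C) (conj (closed_openC cC) xC).
by rewrite C0 ltxx.
Qed.

(** Points whose images under [pi_E] share an edge thus lie on one halfline, where the speed
    determines the point. *)
Lemma pi_E_halfline e x : pi_E x e -> halfline e x.
Proof.
have [q [xq qx]] := tpoint_repr x; rewrite /pi_E -qx; case: eqP => [q0|_] /=.
  case=> ->; first exact: halfline_tedge.
  suff : halfline (Defs.opp (tedge x)) (tpoint (tedge x) q) by rewrite -xq.
  by apply/halfline_tpointE; right; rewrite Defs.oppK.
by move=> ->; exact: halfline_tedge.
Qed.

(** The Fenchel-Young inequality at [p = 0] bounds the Lagrangian below by [- H e 0], uniformly over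
    the finitely many edges. *)
Lemma integrable_lagrangian mu :
  (\int[mu]_x (lagrangian H x)%:E < +oo)%E ->
  mu.-integrable setT (EFin \o lagrangian H).
Proof.
apply: (integrable_of_lower_bound measurable_lagrangian (g := cst (- \sum_e `|H e 0|))).
  exact: finite_measure_integrable_cst.
move=> x /=; have [q [-> _]] := tpoint_repr x; rewrite (lagrangian_tpoint HH).
apply: le_trans (fenchel_young HH (tedge x) 0 q%:num); rewrite mul0r add0r lerN2.
by rewrite (bigD1 (tedge x))//= (le_trans (ler_norm _))// lerDl sumr_ge0.
Qed.

(* Both minimization problems say that [\int L - <w, rotation>] is at least [- a],
   with equality for [mu1] and [mu2], hence also for their midpoint. *)
Lemma calibrated_graph_property (w : cochain1 R G) (a : R) mu1 mu2 :
  closed_measures mu1 -> closed_measures mu2 ->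
  (\int[mu1]_x (lagrangian H x)%:E = (pairing w (rotation mu1) - a)%:E)%E ->
  (\int[mu2]_x (lagrangian H x)%:E = (pairing w (rotation mu2) - a)%:E)%E ->
  (forall nu, closed_measures nu ->
    rotation nu = 2^-1 *: (rotation mu1 + rotation mu2) ->
    ((pairing w (rotation nu) - a)%:E <= \int[nu]_x (lagrangian H x)%:E)%E) ->
  forall x y, supp mu1 x -> supp mu2 y -> x <> y -> pi_E x `&` pi_E y = set0.
Proof.
move=> c1 c2 e1 e2 wa x y xs ys xy.
have mid : action_minimizing (midpoint mu1 mu2).
  split=> [|nu cnu]; first exact: closed_midpoint.
  rewrite rotation_midpoint// => rnu; apply: le_trans (wa nu cnu rnu).
  rewrite integral_midpoint; try apply: integrable_lagrangian; last 2 first.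
  - by rewrite e1 ltry.
  - by rewrite e2 ltry.
  rewrite e1 e2 rnu pairingZ pairingD -EFinD -EFinM lee_fin; lra.
have [b hb] := minimizing_supp mid.
have ys' : supp (midpoint mu1 mu2) y by exact: supp_midpointr.
have xs' : supp (midpoint mu1 mu2) x by exact: supp_midpointl.
apply/seteqP; split=> // e [/pi_E_halfline xe /pi_E_halfline ye]; apply: xy.
by apply: (halfline_eq xe ye); rewrite (hb _ xs' _ xe) (hb _ ys' _ ye).
Qed.

(** Links the linear term of [lagrangian_form] to homology: both sides are sums over the fibres of
    [tedge]. *)
Lemma integral_form (w : cochain1 R G) mu : closed_measures mu ->
  mu.-integrable setT (fun x => (tspeed x * w (tedge x))%:E) /\
  (\int[mu]_x (tspeed x * w (tedge x))%:E = (pairing w (rotation mu))%:E)%E.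
Proof.
move=> [fmu _]; have ht : edge_selection (@tedge R G).
  by split; [exact: halfline_tedge|exact: measurable_tedge].
have mT e : measurable_fun setT (fun q : R => q * w e) by exact: measurable_funM.
split.
  apply: (@le_integrable _ _ _ _ setT _ _ (fun x => ((\sum_e `|w e|)%:E * (tspeed x)%:E)%E)) => //.
  - by apply/measurable_EFinP; exact: (measurable_selection ht mT).
  - move=> x _; rewrite -EFinM /= lee_fin normrM mulrC.
    rewrite [leRHS]normrM ler_wpM2r// [leRHS]ger0_norm ?sumr_ge0//.
    by rewrite (bigD1 (tedge x))//= lerDl sumr_ge0.
  - by apply: integrableZl => //; exact: integrable_tspeed.
rewrite (integral_selection ht mu mT) pairing_sum big_enum/= -sumEFin.
apply: eq_bigr => e _; have It := integrable_tspeed fmu (measurable_tedge e).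
under eq_integral do rewrite EFinM.
rewrite integralZr//; last exact: measurable_tedge.
rewrite EFinM /Rintegral (integral_halfline_selection ht mu e) fineK//.
by apply: integrable_fin_num => //; exact: measurable_tedge.
Qed.

Lemma integrable_lagrangian_form (w : cochain1 R G) mu :
  closed_measures mu -> (\int[mu]_x (lagrangian_form H w x)%:E < +oo)%E ->
  mu.-integrable setT (EFin \o lagrangian H) /\
  mu.-integrable setT (EFin \o lagrangian_form H w).
Proof.
move=> cmu lty; have [Iw _] := integral_form w cmu.
have If : mu.-integrable setT (EFin \o lagrangian_form H w).
  (* The Fenchel-Young inequality at [p = w e] bounds [lagrangian_form] below by [- H e (w e)]. *)
  apply: (integrable_of_lower_bound (g := cst (- \sum_e `|H e (w e)|))) lty.
  - apply: measurable_funB; first exact: measurable_lagrangian.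
    by apply/measurable_EFinP; exact: measurable_int Iw.
  - exact: finite_measure_integrable_cst.
  - move=> x /=; have [q [-> _]] := tpoint_repr x.
    rewrite (lagrangian_form_tpoint HH) lerBrDr.
    apply: le_trans (fenchel_young HH (tedge x) (w (tedge x)) q%:num).
    rewrite addrC [q%:num * _]mulrC lerD2l lerN2 (bigD1 (tedge x))//=.
    by rewrite (le_trans (ler_norm _))// lerDl sumr_ge0.
split => //; apply: eq_integrable (integrableD measurableT If Iw) => // x _ /=.
by rewrite -EFinD /lagrangian_form subrK.
Qed.

Lemma integral_lagrangian_form (w : cochain1 R G) mu :
  closed_measures mu -> mu.-integrable setT (EFin \o lagrangian H) ->
  (\int[mu]_x (lagrangian_form H w x)%:E =
   \int[mu]_x (lagrangian H x)%:E - (pairing w (rotation mu))%:E)%E.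
Proof.
move=> cmu IL; have [Iw <-] := integral_form w cmu.
by rewrite -(integralB measurableT IL Iw); apply: eq_integral.
Qed.

Lemma closed_rotation mu : closed_measures mu -> homology1 (rotation mu).
Proof.
move=> [_ cmu]; apply/ffunP => v; rewrite /boundary.
(* Closedness tested on the indicator function of [v] is the vanishing of the boundary at [v]. *)
rewrite !ffunE -(cmu (fun u => (v == u)%:R)) /form_integral /pairing /extend.
by rewrite sum_ffunE; apply: eq_bigr => e _; rewrite !ffunE.
Qed.

(** The calibrated case with [w = 0] and [a = - beta h]: both measures, and their midpoint, have
    rotation vector [h]. *)
Lemma graph_property_rotation (h : chain1 R G) :
  pi_E_injective_on (mather_rotation H h).
Proof.
have min mu : minimizing_rotation H h mu -> action_minimizing mu.
  move=> [cmu rmu imu]; split=> // nu cnu rnu; rewrite imu.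
  by apply: ereal_inf_lbound; exists nu => //; rewrite /= rnu.
move=> x y [mu1 m1 xs] [mu2 m2 ys]; have [c1 r1 i1] := m1; have [c2 r2 i2] := m2.
have bfin : beta H h \is a fin_num.
  by rewrite -i1; exact: (integrable_fin_num measurableT (minimizing_integrable (min _ m1))).
apply: (calibrated_graph_property (w := 0) (a := - fine (beta H h)) c1 c2) xs ys.
- by rewrite pairing0l sub0r opprK fineK.
- by rewrite pairing0l sub0r opprK fineK.
- move=> nu cnu; rewrite r1 r2 pairing0l sub0r opprK fineK// => rnu.
  apply: ereal_inf_lbound; exists nu => //; split=> //=.
  by rewrite rnu scalerDr -scalerDl -[RHS]scale1r; congr (_ *: _); lra.
Qed.

(** The calibrated case with [w] representing [c] and [a = alpha c]; the lower bound on actions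
    expresses that [alpha] is a supremum. *)
Lemma graph_property_class (c : cohomology1 R G) :
  pi_E_injective_on (mather_class H c).
Proof.
move=> x y [mu1 [c1 m1] xs] [mu2 [c2 m2] ys].
pose w : cochain1 R G := repr c.
have wc : cohom_class w = c by exact: reprK.
have afin : alpha H c \is a fin_num.
  (* A competitor of finite action makes [beta] less than [+oo] at its rotation vector. *)
  have aNoo : (-oo < alpha H c)%E.
    have [nu [b [cnu _ IL _]]] := barycentric_competitor HH (@selection_sel R G (edge0 G)) c1.
    apply: lt_le_trans (ereal_sup_ubound _); last first.
      by exists (rotation nu) => //; exact: closed_rotation.
    have : (beta H (rotation nu) < +oo)%E.
      apply: le_lt_trans (integrable_lty measurableT IL).
      by apply: ereal_inf_lbound; exists nu.
    by case: (beta _ _) => [r||]//; rewrite ?ltNyr ?ltNyy.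
  (* The integral of [lagrangian_form] for [mu1], equal to [- alpha], is now below [+oo], hence
     finite. *)
  have := integrable_lagrangian_form (w := w) c1; rewrite m1// lteNl => /(_ aNoo)[_ If].
  have := integrable_fin_num measurableT If.
  by rewrite [X in X \is a fin_num](m1 w wc) fin_numN.
have act mu : closed_measures mu -> (forall w, cohom_class w = c ->
    \int[mu]_x (lagrangian_form H w x)%:E = - alpha H c)%E ->
    (\int[mu]_x (lagrangian H x)%:E = (pairing w (rotation mu) - fine (alpha H c))%:E)%E.
  move=> cmu /(_ w wc) mmu.
  have [|IL If] := integrable_lagrangian_form (w := w) cmu.
    by rewrite mmu -(fineK afin) -EFinN ltry.
  have := integral_lagrangian_form w cmu IL; rewrite mmu -(fineK afin).
  have := integrable_fin_num measurableT IL.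
  rewrite -[X in X \is a fin_num]/(\int[mu]_x (lagrangian H x)%:E)%E.
  case: (\int[mu]_x (lagrangian H x)%:E)%E => // r _.
  by rewrite -EFinN -EFinB => -[] rE; congr EFin; lra.
apply: (calibrated_graph_property (w := w) (a := fine (alpha H c)) c1 c2) xs ys.
- exact: act.
- exact: act.
- move=> nu cnu _.
  (* The cycle [rotation nu] is admissible in the supremum [alpha], so [beta] there is at least the
     pairing minus [alpha]. *)
  have := ereal_sup_ubound (ex_intro2 _ _ (rotation nu) (closed_rotation cnu) erefl :
    [set (cohom_pairing c h)%:E - beta H h | h in @homology1 R G]%E _).
  have bnu : (beta H (rotation nu) <= \int[nu]_x (lagrangian H x)%:E)%E.
    by apply: ereal_inf_lbound; exists nu.
  move=> ca; apply: le_trans bnu; move: ca.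
  rewrite -[ereal_sup _]/(alpha H c) -(fineK afin) /cohom_pairing -/w.
  case: (beta H (rotation nu)) => [r||]; rewrite ?leey//.
  by rewrite -EFinB !lee_fin; lra.
Qed.

End Minimizers.

Theorem corollary6p4 (R : realType) (G : graph)
  (G_connected : connected_graph G) (G_loopless : loopless G)
  (H : edge G -> R -> R) (H_hamiltonian : hamiltonian H)
  (c : cohomology1 R G) (h : chain1 R G) (h_cycle : homology1 h) :
  pi_E_injective_on (mather_class H c) /\
  pi_E_injective_on (mather_rotation H h).
Proof.
split; [exact: graph_property_class|exact: graph_property_rotation].
Qed.
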